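(* Let $\mathbf x=(x_1,x_2,x_3)\in\mathbb Z_{\ge1}^3$ and let $\mathbf q=(\mathbf r,\mathbf x)$, where $\mathbf r$ is one of (i) $\mathbf r=(1,\,1+x_1,\,(1+x_1)(1+x_2))$; (ii) $\mathbf r=(1+x_2,\,1+x_1(1+x_2),\,(1+x_1(1+x_2))(1+x_2))$; (iv) $\mathbf r=(1,\,(1+x_1)(1+x_3),\,(1+x_1)(1+x_2(1+x_3)))$. Then the $h^*$-polynomial of $\Delta_{(1,\mathbf q)}$ is unimodal.
   Context: For $\mathbf q=(q_1,\dots,q_n)\in\mathbb Z_{\ge1}^n$ with $q_1\le\cdots\le q_n$, let $\Delta_{(1,\mathbf q)}=\mathrm{conv}\{e_1,\dots,e_n,-\sum_{i=1}^n q_ie_i\}\subset\mathbb R^n$. Given distinct positive integers $r_1<r_2<r_3$ and positive integers $x_1,x_2,x_3$, $\mathbf q=(\mathbf r,\mathbf x)$ denotes the vector consisting of $x_1$ copies of $r_1$, then $x_2$ copies of $r_2$, then $x_3$ copies of $r_3$. For a lattice polytope $P\subset\mathbb R^n$ of dimension $\dim P$, its Ehrhart series is $\sum_{t\ge0}|tP\cap\mathbb Z^n|z^t=h^*(P;z)/(1-z)^{\dim P+1}$, where $h^*(P;z)=h_0^*+h_1^*z+\cdots+h_s^*z^s$ is a polynomial with nonnegative integer coefficients, the $h^*$-polynomial. A polynomial $\sum_{i=0}^s p_iz^i$ is unimodal if there is $t$ with $p_0\le\cdots\le p_t\ge\cdots\ge p_s$. *)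

(* Defs.v *)
From HB Require Import structures.
From mathcomp Require Import all_boot all_order all_algebra.
From mathcomp Require Import finmap.
From mathcomp Require Import boolp classical_sets cardinality reals Rstruct.
Set Implicit Arguments. Unset Strict Implicit. Unset Printing Implicit Defensive.
Import Order.TTheory GRing.Theory Num.Theory.
Local Open Scope classical_set_scope.
Local Open Scope ring_scope.

Notation RR := Rdefinitions.R.

Definition qvec (r1 r2 r3 x1 x2 x3 : nat) : seq nat :=
  nseq x1 r1 ++ nseq x2 r2 ++ nseq x3 r3.

Definition conv (n : nat) (V : seq 'rV[RR]_n) : set 'rV[RR]_n :=
  [set y | exists lam : 'I_(size V) -> RR,
     (forall i, 0 <= lam i) /\ \sum_i lam i = 1 /\
     y = \sum_i lam i *: V`_i].

Definition polydim (n : nat) (V : seq 'rV[RR]_n) : nat :=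
  \rank (\matrix_(i < (size V).-1) (V`_i.+1 - V`_0)).

Definition simplex_verts (q : seq nat) : seq 'rV[RR]_(size q) :=
  [seq delta_mx 0 i | i <- enum 'I_(size q)] ++
  [:: \row_(i < size q) - ((nth 0%N q i)%:R : RR)].

Definition lattice_count (n : nat) (V : seq 'rV[RR]_n) (t : nat) : nat :=
  (#|` fset_set [set z : 'rV[int]_n |
        exists2 y, y \in conv V & map_mx (fun a : int => a%:~R : RR) z = t%:R *: y] |)%fset.

(* coefficients of the h^*-polynomial: sum_t L(t) z^t = h^*(z) / (1-z)^(dim P + 1),
   i.e. h^*_k = sum_(j <= k) (-1)^j C(d+1, j) L(k-j), with d = dim P. *)
Definition hstar_coef (n : nat) (V : seq 'rV[RR]_n) (k : nat) : int :=
  \sum_(0 <= j < k.+1)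
    (-1) ^+ j * ('C((polydim V).+1, j))%:R * (lattice_count V (k - j))%:R.

(* unimodality of a coefficient sequence (indexed by all k; coefficients beyond
   the degree are 0) *)
Definition unimodal (c : nat -> int) : Prop :=
  exists t : nat, (forall i, (i < t)%N -> c i <= c i.+1) /\
                  (forall i, (t <= i)%N -> c i.+1 <= c i).

(* Main.v *)
Require Import Defs.
From mathcomp Require Import all_boot all_order all_algebra.
From mathcomp Require Import finmap zify ring.
From mathcomp Require Import boolp classical_sets cardinality Rstruct.
Set Implicit Arguments. Unset Strict Implicit. Unset Printing Implicit Defensive.
Import Order.TTheory GRing.Theory Num.Theory.
Local Open Scope ring_scope.

(* Write Q = 1 + sum q and w(s) = s - sum_i floor(q_i s / Q). A lattice point z
   of the t-th dilate is determined by s = t - sum_i z_i, i.e. Q times its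
   (dilated) barycentric coordinate at the vertex -q, and the nonnegative
   integers y_i = z_i + floor(q_i s / Q), subject to w(s) + sum_i y_i = t. As
   w(p Q + b) = p + w(b), the Ehrhart series is
   (sum_(b < Q) z^w(b)) / (1 - z)^(n+1), so h* = sum_(b < Q) z^w(b).
   For the three families Q factors, and writing b in the corresponding mixed
   radix shows, with [k] = 1 + z + ... + z^(k-1), that h* is
     (i)   [1+x1] [1+x2] [1+x3],
     (ii)  T(x1, 1+x2) [1+x3],
     (iv)  T(x2, 1+x3) [1+x1],
   where T(x, a) = [x+a] + (a+1) z [x] [a-1] is symmetric and unimodal. Products
   of symmetric unimodal polynomials with [k] are again symmetric unimodal. *)

(** * Geometric sums and symmetric unimodal polynomials *)

Definition geom (n : nat) : {poly int} := \sum_(i < n) 'X^i.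

Lemma geomS n : geom n.+1 = geom n + 'X^n.
Proof. by rewrite /geom big_ord_recr. Qed.

Lemma geom1 : geom 1 = 1.
Proof. by rewrite /geom big_ord1 expr0. Qed.

Lemma geomD m n : geom (m + n) = geom m + 'X^m * geom n.
Proof.
rewrite /geom big_split_ord /= mulr_sumr; congr (_ + _).
by apply: eq_bigr => i _; rewrite exprD.
Qed.

Lemma geomSl n : geom n.+1 = 1 + 'X * geom n.
Proof. by rewrite -add1n geomD geom1 expr1. Qed.

Lemma mul_geom n : (1 - 'X) * geom n = 1 - 'X^n.
Proof.
elim: n => [|n IH]; first by rewrite /geom big_ord0 mulr0 expr0 subrr.
by rewrite geomS mulrDr IH exprS; ring.
Qed.

(* The centre of symmetry is d/2, so d need not be the degree of p. *)
Definition symunimodal (d : nat) (p : {poly int}) : Prop :=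
  [/\ forall i, (d < i)%N -> p`_i = 0,
      forall i, (i <= d)%N -> p`_(d - i) = p`_i,
      forall i, 0 <= p`_i
    & forall i j, (i <= j)%N -> (i + j <= d)%N -> p`_i <= p`_j].

(** The mode is [d./2]: up to it monotonicity applies directly, and beyond it reflection carries the
    pair [i], [i.+1] back to the lower half. *)
Lemma symunimodal_unimodal d (p : {poly int}) (c : nat -> int) :
  (forall k, c k = p`_k) -> symunimodal d p -> unimodal c.
Proof.
move=> ec [p0 psym pge0 pmono]; exists (d./2); split=> i hi; rewrite !ec.
  by apply: pmono; lia.
have [hd|hd] := ltnP d i.+1; first by rewrite p0.
by rewrite -(psym i.+1) //; apply: pmono; lia.
Qed.

Lemma symunimodal1 : symunimodal 0 1.
Proof.
split=> [i hi|i|i|i j hij]; rewrite ?coef1.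
- by case: i hi.
- by rewrite leqn0 => /eqP->.
- by case: eqP.
- by rewrite leqn0 addn_eq0 => /andP[/eqP-> /eqP->].
Qed.

Lemma symunimodalD d (p r : {poly int}) :
  symunimodal d p -> symunimodal d r -> symunimodal d (p + r).
Proof.
move=> [p0 ps pge pm] [r0 rs rge rm].
split=> [i hi|i hi|i|i j hij hd]; rewrite !coefD.
- by rewrite p0 ?r0.
- by rewrite ps ?rs.
- by rewrite addr_ge0.
- by rewrite lerD ?pm ?rm.
Qed.

Lemma symunimodalMn d (p : {poly int}) n : symunimodal d p -> symunimodal d (p *+ n).
Proof.
move=> [p0 ps pge pm]; split=> [i hi|i hi|i|i j hij hd]; rewrite !coefMn.
- by rewrite p0 // mul0rn.
- by rewrite ps.
- by rewrite mulrn_wge0.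
- by rewrite lerMn2r pm ?orbT.
Qed.

Lemma symunimodalX d (p : {poly int}) : symunimodal d p -> symunimodal d.+2 ('X * p).
Proof.
move=> [p0 ps pge pm]; split=> [i hi|i hi|i|i j hij hd]; rewrite !coefXM.
- by rewrite ifF ?p0 //; lia.
- have [-> | i0] := eqVneq i 0%N; first by rewrite p0 //; lia.
  have [hd|hd] := leqP i d.+1; last by rewrite ifT ?p0 //; lia.
  rewrite ifF; last by lia.
  by rewrite -(ps i.-1); [congr (_`_ _)|]; lia.
- by case: ifP.
- have [// | i0] := eqVneq i 0%N; first by case: ifP.
  by rewrite ifF ?pm //; lia.
Qed.

(** Multiplying by [1 - 'X] telescopes [geom n.+1], so consecutive coefficients of the product
    differ by [p_(i+1) - p_(i-n)]. These indices sum to at most [d] exactly when [2i + 1 <= d + n],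
    so the product increases up to its middle. *)
Lemma symunimodalMgeom d (p : {poly int}) n :
  symunimodal d p -> symunimodal (d + n) (p * geom n.+1).
Proof.
move=> [p0 ps pge pm].
have co k : (p * geom n.+1)`_k = \sum_(v < n.+1) (p * 'X^v)`_k.
  by rewrite /geom mulr_sumr coef_sum.
have sym k : (k <= d + n)%N ->
    (p * geom n.+1)`_(d + n - k) = (p * geom n.+1)`_k.
  move=> hk; rewrite !co (reindex_inj rev_ord_inj) /=.
  apply: eq_bigr => v _; have hv := ltn_ord v; rewrite !coefMXn.
  have [h1|h1] := ltnP k v; case: ifP => h2 //.
  - by rewrite p0 //; lia.
  - have [h3|h3] := leqP (k - v) d; last by rewrite p0.
    lia.
  - have [h3|h3] := leqP (k - v) d; last by rewrite !p0 //; lia.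
    by rewrite -(ps (k - v)%N) //; congr (_`_ _); lia.
have step i : (i.*2.+1 <= d + n)%N ->
    (p * geom n.+1)`_i <= (p * geom n.+1)`_i.+1.
  move=> hi; rewrite -subr_ge0.
  have -> : (p * geom n.+1)`_i.+1 - (p * geom n.+1)`_i
      = (p * (1 - 'X^(n.+1)))`_i.+1.
    by rewrite -mul_geom mulrCA mulrBl mul1r coefB coefXM.
  rewrite mulrBr mulr1 coefB coefMXn subr_ge0; case: ifP => // h.
  by apply: pm; lia.
have mono i j : (i <= j)%N -> (j.*2 <= d + n)%N ->
    (p * geom n.+1)`_i <= (p * geom n.+1)`_j.
  elim: j => [|j IH] hij hj; first by move: hij; rewrite leqn0 => /eqP->.
  move: hij; rewrite leq_eqVlt => /orP[/eqP-> //|hij].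
  by apply: le_trans (step _ _); [apply: IH|]; lia.
split=> // [i hi|i|i j hij hd].
- rewrite co big1 // => v _; have hv := ltn_ord v; rewrite coefMXn.
  by case: ifP => // h; rewrite p0 //; lia.
- rewrite co sumr_ge0 // => v _; rewrite coefMXn; case: ifP => //.
- have [h|h] := leqP j.*2 (d + n); first exact: mono.
  (* Past the middle, [j] is replaced by its mirror image [d + n - j], which is still at least
     [i]. *)
  by rewrite -(sym j); [apply: mono|]; lia.
Qed.

Lemma symunimodal_geom n : (0 < n)%N -> symunimodal n.-1 (geom n).
Proof.
case: n => // n _; rewrite -[geom _]mul1r.
exact: (symunimodalMgeom n symunimodal1).
Qed.

(** * Mixed radix sums and the polynomials T(x, a) *)

Lemma sum_ord_mul (V : nmodType) (m n : nat) (F : nat -> V) :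
  \sum_(i < m * n) F i = \sum_(i < m) \sum_(j < n) F (i * n + j)%N.
Proof.
elim: m => [|m IH]; first by rewrite !big_ord0.
by rewrite mulSn addnC big_split_ord big_ord_recr /= IH.
Qed.

(** For [a > 0] this is the h*-polynomial attached to [x] copies of [a] and [a.-1] copies of
    [1 + x * a], for which Q = (1 + xa)a. *)
Definition twist (x a : nat) : {poly int} :=
  \sum_(u < (1 + x * a) * a)
    'X^(u - x * (u %/ (1 + x * a)) - a.-1 * (u %/ a)).

(* Shifting the window of length a by one replaces 'X^t by 'X^(t+1). *)
Lemma window_sum (a t : nat) : (0 < a)%N -> (t <= a)%N ->
  \sum_(p < a) 'X^((t + p) %% a + (t + p) %/ a) = geom a - 1 + 'X^t :> {poly int}.
Proof.
case: a => // a _; elim: t => [_|t IH ht].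
  rewrite expr0 subrK; apply: eq_bigr => p _.
  by rewrite add0n modn_small ?divn_small // addn0.
rewrite big_ord_recr /=; have := IH (ltnW ht).
rewrite big_ord_recl /= addn0 modn_small // divn_small // addn0 => /eqP.
rewrite addrC -subr_eq => /eqP eqS.
have -> : (t.+1 + a = 1 * a.+1 + t)%N by lia.
rewrite modnMDl divnMDl // modn_small // divn_small // addn0.
under eq_bigr => i _ do rewrite addSnnS.
by rewrite -eqS addn1; ring.
Qed.

Lemma twistE x a : (0 < a)%N ->
  twist x a = geom (x + a) + ('X * (geom x * geom a.-1)) *+ a.+1.
Proof.
move=> a0; rewrite /twist mulnC (sum_ord_mul a _ (fun u =>
  'X^(u - x * (u %/ (1 + x * a)) - a.-1 * (u %/ a)))) exchange_big /=.
pose f k := ((k %% a) + k %/ a)%N.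
(* With u = p(1 + xa) + r = pxa + (r + p), the terms in px cancel and the exponent depends on
   [r + p] only. The sum over [p] thus runs over a window of length [a] starting at [r]. *)
rewrite (eq_bigr (fun r : 'I_(1 + x * a) =>
   \sum_(p < a) 'X^(f (r + p)%N))); last first.
  move=> r _; apply: eq_bigr => p _; congr ('X^_).
  rewrite divnMDl // divn_small // addn0.
  have -> : (p * (1 + x * a) + r = p * x * a + (r + p))%N by lia.
  rewrite divnMDl // /f; have := divn_eq (r + p) a.
  move: (r + p)%N => k; set c := (k %/ a)%N; set l := (k %% a)%N => ->.
  by move: a.-1 (prednK a0) (nat_of_ord p) => a' ea p'; nia.
pose W k : {poly int} := \sum_(p < a) 'X^(f (k + p)%N).
have Wmul s t : (t <= a)%N -> W (s * a + t)%N = 'X^s * (geom a - 1 + 'X^t).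
  move=> ta; rewrite -window_sum // mulr_sumr; apply: eq_bigr => p _.
  by rewrite -exprD /f -addnA divnMDl // modnMDl addnCA.
(* The starting points r < 1 + xa are the s a + t with s < x, t < a, and the last one, r = xa. *)
rewrite (eq_bigr (fun r : 'I_(1 + x * a) => W r)) // addnC big_split_ord /=.
rewrite (sum_ord_mul x a W) big_ord1 Wmul //.
under eq_bigr => s _.
  under eq_bigr => t _ do rewrite Wmul 1?ltnW //.
  rewrite -mulr_sumr big_split /= sumr_const card_ord -/(geom a); over.
rewrite -mulr_suml -/(geom x) geomD.
have -> : geom a = 1 + 'X * geom a.-1 by rewrite -geomSl prednK.
rewrite expr0; move: (geom x) (geom a.-1) ('X^x) => g h y.
by ring.
Qed.

(** Both summands of [twistE] have centre (x + a - 1)/2: the factor ['X] makes up for the lower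
    degree of [x][a-1]. *)
Lemma symunimodal_twist x a : (0 < x)%N -> (1 < a)%N ->
  symunimodal (x + a).-1 (twist x a).
Proof.
move=> x0 a1; rewrite twistE; last by lia.
apply: symunimodalD; first by apply: symunimodal_geom; lia.
apply: symunimodalMn.
have -> : (x + a).-1 = (x.-1 + a.-2).+2 by lia.
apply: symunimodalX.
have -> : a.-1 = a.-2.+1 by lia.
by apply: symunimodalMgeom; apply: symunimodal_geom.
Qed.

(** * Barycentric coordinates and dimension of the simplex *)

Lemma convE n (V : seq 'rV[RR]_n) m (y : 'rV[RR]_n) : size V = m ->
  conv V y <-> exists lam : 'I_m -> RR, (forall i, 0 <= lam i) /\
    \sum_i lam i = 1 /\ y = \sum_i lam i *: V`_i.
Proof. by case: m /. Qed.

Lemma polydimE n (V : seq 'rV[RR]_n) m : size V = m.+1 ->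
  polydim V = \rank (\matrix_(i < m) (V`_i.+1 - V`_0)).
Proof. by rewrite /polydim => ->. Qed.

Lemma size_simplex_verts q : size (simplex_verts q) = (size q).+1.
Proof. by rewrite size_cat size_map size_enum_ord addn1. Qed.

Lemma simplex_comb q (c : 'I_(size q).+1 -> RR) (j : 'I_(size q)) :
  (\sum_k c k *: (simplex_verts q)`_k) 0 j
  = c (widen_ord (leqnSn _) j) - c ord_max * (nth 0%N q j)%:R.
Proof.
rewrite big_ord_recr /= mxE summxE; congr (_ + _).
  rewrite (bigD1 j) //= big1 => [|i ij]; rewrite !mxE nth_cat size_map
    size_enum_ord ltn_ord (nth_map j) ?size_enum_ord // nth_ord_enum !mxE eqxx /=.
    by rewrite eqxx mulr1 addr0.
  by rewrite eq_sym (negbTE ij) mulr0.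
by rewrite mxE nth_cat size_map size_enum_ord ltnn subnn /= mxE mulrN.
Qed.

Lemma sum_nth (R : nmodType) (q : seq nat) (F : nat -> R) :
  \sum_(i < size q) F (nth 0%N q i) = \sum_(x <- q) F x.
Proof. by rewrite (big_nth 0%N) big_mkord. Qed.

Lemma sum_nthR q : \sum_(i < size q) (nth 0%N q i)%:R = (sumn q)%:R :> RR.
Proof. by rewrite (sum_nth q (fun x => x%:R)) sumnE natr_sum. Qed.

Lemma conv_simplexP q (y : 'rV[RR]_(size q)) : conv (simplex_verts q) y <->
  exists (lam : 'I_(size q) -> RR) (l : RR),
    [/\ forall i, 0 <= lam i, 0 <= l, \sum_i lam i + l = 1
      & forall i, y 0 i = lam i - l * (nth 0%N q i)%:R].
Proof.
rewrite (convE _ (size_simplex_verts q)); split.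
  move=> [c [c0 [c1 ->]]].
  exists (fun i => c (widen_ord (leqnSn _) i)), (c ord_max); split=> //.
    by rewrite -c1 big_ord_recr.
  by move=> i; rewrite simplex_comb.
move=> [lam [l [lam0 l0 e1 ey]]].
pose c := fun k => oapp lam l (unlift ord_max k).
have cw i : c (widen_ord (leqnSn _) i) = lam i.
  have -> : widen_ord (leqnSn _) i = lift ord_max i.
    by apply: val_inj; rewrite /= /bump leqNgt ltn_ord.
  by rewrite /c liftK.
have cm : c ord_max = l by rewrite /c unlift_none.
exists c; split=> [k|]; first by rewrite /c; case: (unlift ord_max k) => /=.
split; first by rewrite big_ord_recr /= cm -e1; under eq_bigr do rewrite cw.
by apply/rowP => j; rewrite simplex_comb cw cm ey.
Qed.

(** The vertices are affinely independent: in a vanishing combination with coefficient sum 0, the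
    coefficient at e_j is q_j times the one at -q, so the latter times 1 + sum q is 0. *)
Lemma polydim_simplex q : polydim (simplex_verts q) = size q.
Proof.
rewrite (polydimE (size_simplex_verts q)); apply/eqP; apply: inj_row_free => v hv.
pose c := fun k => oapp (v 0) (- \sum_i v 0 i) (unlift ord0 k).
have cl i : c (lift ord0 i) = v 0 i by rewrite /c liftK.
have c0 : c ord0 = - \sum_i v 0 i by rewrite /c unlift_none.
have sc : \sum_k c k = 0.
  by rewrite big_ord_recl; under eq_bigr do rewrite cl; rewrite c0 addNr.
have comb : \sum_k c k *: (simplex_verts q)`_k = 0.
  rewrite big_ord_recl c0 -[RHS]hv mulmx_sum_row.
  under [RHS]eq_bigr do rewrite rowK scalerBr.
  rewrite sumrB -scaler_suml addrC scaleNr; congr (_ - _).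
  by apply: eq_bigr => i _; rewrite cl.
have cw j : c (widen_ord (leqnSn _) j) = c ord_max * (nth 0%N q j)%:R.
  by have /rowP/(_ j) := comb; rewrite simplex_comb mxE => /eqP; rewrite subr_eq0 => /eqP.
have cm : c ord_max = 0.
  move: sc; rewrite big_ord_recr /=; under eq_bigr do rewrite cw.
  rewrite -mulr_sumr sum_nthR -[X in _ + X]mulr1 -mulrDr natr1 => /eqP.
  by rewrite mulf_eq0 pnatr_eq0 orbF => /eqP.
apply/rowP => i; rewrite mxE -cl.
case: (unliftP ord_max (lift ord0 i)) => [j|] -> //.
by have := cw j; rewrite cm mul0r => <-; congr c; apply: val_inj;
  rewrite /= /bump leqNgt ltn_ord.
Qed.

(* With Q = 1 + sum q, the barycentric coordinates of z (scaled by t) are s / Q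
   at the vertex -q and z_i + q_i s / Q at e_i. *)
Lemma mem_dilate q t (z : 'rV[int]_(size q)) :
  (exists2 y, conv (simplex_verts q) y &
     map_mx (fun a : int => a%:~R : RR) z = t%:R *: y) <->
  exists s : nat, s%:Z + \sum_i z 0 i = t%:Z /\
    forall i, 0 <= (sumn q).+1%:Z * z 0 i + (nth 0%N q i * s)%N%:Z.
Proof.
split.
  move=> [y /conv_simplexP[lam [l [lam0 l0 e1 ey]]] ez].
  have zE i : (z 0 i)%:~R = t%:R * lam i - t%:R * l * (nth 0%N q i)%:R :> RR.
    by have /rowP/(_ i) := ez; rewrite !mxE ey => ->; rewrite mulrBr mulrA.
  have sz : (t%:Z - \sum_i z 0 i)%:~R = (sumn q).+1%:R * (t%:R * l) :> RR.
    rewrite rmorphB rmorph_sum /=; under eq_bigr do rewrite zE.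
    rewrite sumrB -!mulr_sumr sum_nthR.
    have -> : \sum_i lam i = 1 - l by rewrite -e1 addrK.
    by rewrite -natr1 -pmulrn; ring.
  have s0 : 0 <= t%:Z - \sum_i z 0 i.
    by rewrite -(ler0z RR) sz !mulr_ge0.
  exists (absz (t%:Z - \sum_i z 0 i)%R); rewrite gez0_abs //; split; first by ring.
  move=> i; rewrite PoszM gez0_abs // -(ler0z RR) rmorphD !rmorphM /= sz zE -!pmulrn.
  have -> : (sumn q).+1%:R * (t%:R * lam i - t%:R * l * (nth 0%N q i)%:R) +
    (nth 0%N q i)%:R * ((sumn q).+1%:R * (t%:R * l)) =
    (sumn q).+1%:R * (t%:R * lam i) :> RR by ring.
  by rewrite !mulr_ge0.
move=> [s [es hz]].
have [Q eQ] : exists Q : RR, (sumn q).+1%:R = Q by exists (sumn q).+1%:R.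
have Q0 : 0 < Q by rewrite -eQ ltr0n.
have Qn0 : Q != 0 by rewrite gt_eqF.
(* The barycentric coordinate at e_i, scaled by [t]. *)
pose w i : RR := (z 0 i)%:~R + (nth 0%N q i)%:R * (s%:R / Q).
have w0 i : 0 <= w i.
  have : 0 <= ((sumn q).+1%:Z * z 0 i + (nth 0%N q i * s)%N%:Z)%:~R :> RR.
    by rewrite ler0z.
  rewrite PoszM rmorphD !rmorphM /= -!pmulrn eQ.
  have -> : Q * (z 0 i)%:~R + (nth 0%N q i)%:R * s%:R =
     Q * w i by rewrite /w; field.
  by rewrite pmulr_rge0.
have sw : \sum_i w i + s%:R / Q = t%:R :> RR.
  rewrite big_split /= -mulr_suml sum_nthR -rmorph_sum /=.
  have -> : \sum_i z 0 i = t%:Z - s%:Z by rewrite -es; ring.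
  rewrite rmorphB /= -!pmulrn.
  have -> : (sumn q)%:R = Q - 1 :> RR by rewrite -eQ -natr1 addrK.
  by field.
(* For t = 0 one cannot divide by [t]; all scaled coordinates vanish, so z = 0 and the vertex -q
   serves as [y]. *)
have [t0|t0] := posnP t.
  have /eqP : \sum_i w i + s%:R / Q = 0 by rewrite sw t0.
  rewrite paddr_eq0 ?sumr_ge0 ?divr_ge0 // ?ltW // => /andP[/eqP w00 /eqP s0].
  have {}w00 i : w i = 0 by apply: (psumr_eq0P _ w00).
  exists (\row_i - (nth 0%N q i)%:R).
    apply/conv_simplexP; exists (fun=> 0), 1; split=> //.
      by rewrite big1 // add0r.
    by move=> i; rewrite mxE mul1r sub0r.
  apply/rowP => i; rewrite !mxE t0 mul0r.
  by have := w00 i; rewrite /w s0 mulr0 addr0.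
have tn0 : t%:R != 0 :> RR by rewrite pnatr_eq0 -lt0n.
exists (t%:R^-1 *: map_mx (fun a : int => a%:~R : RR) z); last first.
  by rewrite scalerA divff // scale1r.
apply/conv_simplexP.
exists (fun i => w i / t%:R), (s%:R / Q / t%:R); split.
- by move=> i; rewrite divr_ge0.
- by rewrite !divr_ge0 // ltW.
- by rewrite -mulr_suml -mulrDl sw divff.
- by move=> i; rewrite !mxE /w; field; rewrite tn0 Qn0.
Qed.

(** * Weights, lattice points of dilates and the h*-polynomial *)

Definition wt (q : seq nat) (b : nat) : nat :=
  (b - \sum_(x <- q) (x * b) %/ (sumn q).+1)%N.

Definition hpoly (q : seq nat) : {poly int} :=
  \sum_(b < (sumn q).+1) 'X^(wt q b).

(** Ensures that the subtraction in [wt] never truncates. *)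
Lemma wt_le q b : (\sum_(x <- q) (x * b) %/ (sumn q).+1 <= b)%N.
Proof.
rewrite -(leq_pmul2r (ltn0Sn (sumn q))) big_distrl /=.
apply: (@leq_trans (\sum_(x <- q) x * b)).
  by apply: leq_sum => x _; exact: leq_divM.
by rewrite -big_distrl -sumnE /= mulnC leq_mul2l leqnSn orbT.
Qed.

Lemma wtD q p b : wt q (p * (sumn q).+1 + b) = (p + wt q b)%N.
Proof.
rewrite /wt; have hb := wt_le q b.
rewrite (eq_bigr (fun x => x * p + (x * b) %/ (sumn q).+1)%N) => [|x _].
  rewrite big_split -big_distrl -sumnE /=; nia.
by rewrite mulnDr mulnA divnMDl.
Qed.

Lemma coef_sumXn_pow T m k : (geom T ^+ m)`_k =
  \sum_(f : {ffun 'I_m -> 'I_T}) ((\sum_i f i)%N == k)%:R.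
Proof.
rewrite -[m in LHS]card_ord -prodr_const /geom bigA_distr_bigA coef_sum.
apply: eq_bigr => f _.
by rewrite -expr_sum coefXn eq_sym.
Qed.

(** [geom T] stands in for the power series 1/(1 - z), with which it agrees below degree [T]; this
    keeps the counted type finite. *)
Lemma coef_hpoly_geom q T m k : (hpoly q * geom T ^+ m)`_k =
  #|[pred u : 'I_(sumn q).+1 * {ffun 'I_m -> 'I_T} |
      (wt q u.1 + \sum_i u.2 i == k)%N]|%:R.
Proof.
rewrite /hpoly mulr_suml coef_sum -sum1_card natr_sum [RHS]big_mkcond /=.
rewrite [RHS](eq_bigr (fun u : 'I_(sumn q).+1 * {ffun 'I_m -> 'I_T} =>
  (wt q u.1 + \sum_i u.2 i == k)%N%:R)) => [|u _]; last by rewrite inE; case: eqP.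
rewrite -(pair_bigA _ (fun (b : 'I_(sumn q).+1) (f : {ffun 'I_m -> 'I_T}) =>
  (wt q b + \sum_i f i == k)%N%:R)) /=.
apply: eq_bigr => b _; rewrite coefXnM.
have [h|h] := ltnP k (wt q b).
  by rewrite big1 // => f _; case: eqP => //; lia.
rewrite coef_sumXn_pow; apply: eq_bigr => f _.
by rewrite -(eqn_add2l (wt q b)) subnKC.
Qed.

(* u.1 + u.2 0 * Q is the integer s = t - sum_i z_i, divided with remainder
   by Q = 1 + sum q. *)
Definition latpt q T (u : 'I_(sumn q).+1 * {ffun 'I_(size q).+1 -> 'I_T}) :
    'rV[int]_(size q) :=
  \row_i ((u.2 (lift ord0 i))%:Z -
    ((nth 0%N q i * (u.2 ord0 * (sumn q).+1 + u.1)) %/ (sumn q).+1)%N%:Z).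

Lemma sum_Posz (I : finType) (F : I -> nat) : \sum_i (F i)%:Z = (\sum_i F i)%N%:Z.
Proof. by rewrite (big_morph _ PoszD (erefl _)). Qed.

Lemma wt_sum q s :
  s%:Z - \sum_(i < size q) ((nth 0%N q i * s) %/ (sumn q).+1)%N%:Z = (wt q s)%:Z.
Proof.
rewrite sum_Posz (sum_nth q (fun x => (x * s) %/ (sumn q).+1)%N).
by rewrite subzn // wt_le.
Qed.

Lemma sum_latpt q T (u : 'I_(sumn q).+1 * {ffun 'I_(size q).+1 -> 'I_T}) :
  (u.2 ord0 * (sumn q).+1 + u.1)%N%:Z + \sum_i (latpt u) 0 i
  = (wt q u.1 + \sum_i u.2 i)%N%:Z.
Proof.
under [X in _ + X = _]eq_bigr do rewrite mxE.
rewrite sumrB addrCA wt_sum wtD big_ord_recl sum_Posz -PoszD.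
by rewrite addnC -addnA addnCA.
Qed.

(** [latpt] is a bijection from these pairs onto the lattice points; [t < T] leaves room for entries
    up to [t]. *)
Lemma lattice_count_simplex q T t : (t < T)%N ->
  lattice_count (simplex_verts q) t =
  #|[pred u : 'I_(sumn q).+1 * {ffun 'I_(size q).+1 -> 'I_T} |
      (wt q u.1 + \sum_i u.2 i == t)%N]|.
Proof.
case: T => // T tT; set P := [pred u | _].
have latinj : {in P &, injective (@latpt q T.+1)}.
  move=> [b f] [b' f'] /=; rewrite !inE /= => /eqP hu /eqP hv eqp.
  (* The coordinate sum determines s; division by Q then recovers [b] and [f ord0]. *)
  have es : (f ord0 * (sumn q).+1 + b = f' ord0 * (sumn q).+1 + b')%N.
    have := sum_latpt (b, f); have := sum_latpt (b', f').
    by rewrite /= hu hv eqp; lia.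
  have eb : b = b' by apply: val_inj; move/(congr1 (modn^~ (sumn q).+1)): es;
    rewrite !modnMDl !modn_small.
  rewrite eb in es eqp *; congr (_, _); apply/ffunP => k.
  have e0 : f ord0 = f' ord0 by apply: val_inj; move: es => /=; nia.
  case: (unliftP ord0 k) => [i|] -> //; apply: val_inj.
  move/rowP/(_ i): eqp; rewrite !mxE /= e0; lia.
rewrite /lattice_count.
have -> : [set z : 'rV[int]_(size q) |
   exists2 y, y \in conv (simplex_verts q) &
     map_mx (fun a : int => a%:~R : RR) z = t%:R *: y]%classic =
   [set` [fset (@latpt q T.+1 u) | u in P]%fset]%classic.
  apply/seteqP; split=> z /=.
    move=> [y /set_mem hy ez].
    have /mem_dilate[s [es hz]] : exists2 y, conv (simplex_verts q) y &
      map_mx (fun a : int => a%:~R : RR) z = t%:R *: y by exists y.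
    (* No sign is lost in [absz]: Q z_i + q_i s >= 0 forces z_i + floor(q_i s / Q) >= 0. *)
    pose y' i := absz (z 0 i + ((nth 0%N q i * s) %/ (sumn q).+1)%N%:Z)%R.
    have y'E i : (y' i)%:Z = z 0 i + ((nth 0%N q i * s) %/ (sumn q).+1)%N%:Z.
      rewrite gez0_abs //; have := hz i.
      have := divn_eq (nth 0%N q i * s)%N (sumn q).+1.
      have := ltn_pmod (nth 0%N q i * s)%N (ltn0Sn (sumn q)).
      set n := (nth 0%N q i * s)%N.
      by move: (n %% _)%N (n %/ _)%N => l k; nia.
    pose g k := oapp y' (s %/ (sumn q).+1)%N (unlift ord0 k).
    have g0 : g ord0 = (s %/ (sumn q).+1)%N by rewrite /g unlift_none.
    have gl i : g (lift ord0 i) = y' i by rewrite /g liftK.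
    have sE : s = (g ord0 * (sumn q).+1 + s %% (sumn q).+1)%N.
      by rewrite g0 -divn_eq.
    have sg : (wt q (s %% (sumn q).+1) + \sum_k g k = t)%N.
      have := wt_sum q s; rewrite {3}sE wtD big_ord_recl.
      rewrite (eq_bigr (fun i => y' i)) => [|i _]; last by rewrite gl.
      have : \sum_i z 0 i + \sum_(i < size q)
          ((nth 0%N q i * s) %/ (sumn q).+1)%N%:Z = (\sum_i y' i)%N%:Z.
        by rewrite -big_split -sum_Posz; apply: eq_bigr => i _; rewrite y'E.
      move=> e1 e2; apply/eqP; rewrite -eqz_nat addnCA addnA PoszD -e2 -e1 -es.
      by rewrite addrACA addNr addr0.
    have gT k : (g k < T.+1)%N.
      by rewrite ltnS; apply: leq_trans (tT : (t <= T)%N); rewrite -sg (bigD1 k) //=; lia.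
    pose f := [ffun k => inord (g k)] : {ffun 'I_(size q).+1 -> 'I_T.+1}.
    have fE k : f k = g k :> nat by rewrite ffunE inordK.
    pose u := (Ordinal (ltn_pmod s (ltn0Sn (sumn q))), f).
    apply/imfsetP; exists u.
      by rewrite inE /=; under eq_bigr do rewrite fE; rewrite sg.
    by apply/rowP => i; rewrite mxE /= !fE -sE gl y'E addrK.
  move=> /imfsetP[u hu ->].
  have [|y hy ey] := (mem_dilate t (@latpt q T.+1 u)).2.
    exists (u.2 ord0 * (sumn q).+1 + u.1)%N; split.
      by rewrite sum_latpt; move: hu; rewrite inE => /eqP ->.
    move=> i; rewrite mxE.
    have := divn_eq (nth 0%N q i * (u.2 ord0 * (sumn q).+1 + u.1))%N (sumn q).+1.
    set n := (nth 0%N q i * _)%N.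
    by move: (n %% _)%N (n %/ _)%N => l k; nia.
  by exists y => //; apply/mem_set.
by rewrite set_fsetK card_in_imfset // cardE.
Qed.

Lemma coef_1subX_pow m j : ((1 - 'X : {poly int}) ^+ m)`_j = (-1) ^+ j * ('C(m, j))%:R.
Proof.
elim: m j => [|m IH] j.
  by rewrite expr0 coef1 bin0n; case: j => [|j] /=; rewrite ?mulr0 ?expr0.
rewrite exprS mulrBl mul1r coefB coefXM !IH.
case: j => [|j] /=; first by rewrite !bin0 subr0.
by rewrite binS natrD exprS; ring.
Qed.

Lemma coef_mul_trunc (p : {poly int}) T m k : (k < T)%N ->
  (p * (1 - 'X^T) ^+ m)`_k = p`_k.
Proof.
move=> kT; elim: m => [|m IH]; first by rewrite expr0 mulr1.
by rewrite exprSr mulrA mulrBr mulr1 coefB coefMXn kT subr0.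
Qed.

(** (1 - X) [geom k.+1] = 1 - X^(k+1), whose powers do not affect the coefficient of degree [k];
    expanding the product by [coefM] gives the alternating sum in [hstar_coef]. *)
Lemma hstar_simplex q k : hstar_coef (simplex_verts q) k = (hpoly q)`_k.
Proof.
rewrite -(@coef_mul_trunc _ k.+1 (size q).+1) // -mul_geom exprMn mulrCA coefM.
rewrite /hstar_coef polydim_simplex big_mkord; apply: eq_bigr => j _.
rewrite coef_1subX_pow (@lattice_count_simplex _ k.+1) ?ltnS ?leq_subr //.
by rewrite coef_hpoly_geom.
Qed.

(** * Factorization for the three families *)

Lemma sumn_qvec r1 r2 r3 x1 x2 x3 :
  sumn (qvec r1 r2 r3 x1 x2 x3) = (r1 * x1 + (r2 * x2 + r3 * x3))%N.
Proof. by rewrite /qvec !sumn_cat !sumn_nseq. Qed.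

Lemma wt_qvec r1 r2 r3 x1 x2 x3 Q b : Q = (sumn (qvec r1 r2 r3 x1 x2 x3)).+1 ->
  wt (qvec r1 r2 r3 x1 x2 x3) b =
  (b - (x1 * (r1 * b %/ Q) + (x2 * (r2 * b %/ Q) + x3 * (r3 * b %/ Q))))%N.
Proof.
by move=> ->; rewrite /wt /qvec !big_cat /= !big_nseq !iter_addn_0 ![(_ * x1)%N]mulnC
  ![(_ * x2)%N]mulnC ![(_ * x3)%N]mulnC.
Qed.

(** Applied to the r_i, each of which divides Q in all three families. *)
Lemma divn_scale r Q d b : (0 < r)%N -> Q = (r * d)%N -> (r * b %/ Q = b %/ d)%N.
Proof. by move=> r0 ->; rewrite divnMl. Qed.

(** Makes the subtractions in [twist] exact: x floor(u/(1 + xa)) <= floor(u/a), and a floor(u/a) <=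
    u. *)
Lemma twist_exp_le x a u : (0 < a)%N ->
  (x * (u %/ (1 + x * a)) + a.-1 * (u %/ a) <= u)%N.
Proof.
move=> a0; have eu := divn_eq u (1 + x * a); have eu' := divn_eq u a.
have hk : (u %/ (1 + x * a) * x <= u %/ a)%N by rewrite leq_divRL //; nia.
by move: (u %/ (1 + x * a))%N (u %/ a)%N (u %% a)%N eu' hk => p k l -> {eu}; nia.
Qed.

Lemma hpoly_split q m n : (m * n = (sumn q).+1)%N ->
  hpoly q = \sum_(i < m) \sum_(j < n) 'X^(wt q (i * n + j)).
Proof. by rewrite /hpoly => <-; rewrite (sum_ord_mul m n (fun b => 'X^(wt q b))). Qed.

(** For b = (s(1 + x2) + t)(1 + x3) + v the floors are 0, s and s(1 + x2) + t, leaving weight s + t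
    + v. *)
Lemma hpoly_i x1 x2 x3 :
  hpoly (qvec 1 (1 + x1) ((1 + x1) * (1 + x2)) x1 x2 x3)
  = geom (1 + x1) * geom (1 + x2) * geom (1 + x3).
Proof.
have eQ : ((1 + x1) * (1 + x2) * (1 + x3) =
  (sumn (qvec 1 (1 + x1) ((1 + x1) * (1 + x2)) x1 x2 x3)).+1)%N.
  by rewrite sumn_qvec; ring.
rewrite (hpoly_split eQ).
rewrite (sum_ord_mul _ _ (fun u => \sum_(j < 1 + x3) 'X^(wt _ (u * (1 + x3) + j)))).
rewrite /geom -mulrA mulr_suml; apply: eq_bigr => s _.
rewrite mulr_suml mulr_sumr; apply: eq_bigr => t _.
rewrite !mulr_sumr; apply: eq_bigr => v _; rewrite -!exprD (wt_qvec _ eQ); congr ('X^_).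
set b := (_ * (1 + x3) + v)%N.
have hs := ltn_ord s; have ht := ltn_ord t; have hv := ltn_ord v.
rewrite mul1n divn_small; last by rewrite /b; nia.
rewrite (@divn_scale (1 + x1) _ ((1 + x3) * (1 + x2))) //; last by ring.
rewrite (@divn_scale ((1 + x1) * (1 + x2)) _ (1 + x3)) //.
rewrite divnMA /b !divnMDl // (divn_small hv) addn0 divnMDl // (divn_small ht).
nia.
Qed.

(** For b = u(1 + x3) + v the third floor is u, and the other two are those in the exponent of
    [twist]. *)
Lemma hpoly_ii x1 x2 x3 :
  hpoly (qvec (1 + x2) (1 + x1 * (1 + x2)) ((1 + x1 * (1 + x2)) * (1 + x2)) x1 x2 x3)
  = twist x1 (1 + x2) * geom (1 + x3).
Proof.
have eQ : ((1 + x1 * (1 + x2)) * (1 + x2) * (1 + x3) =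
  (sumn (qvec (1 + x2) (1 + x1 * (1 + x2))
    ((1 + x1 * (1 + x2)) * (1 + x2)) x1 x2 x3)).+1)%N.
  by rewrite sumn_qvec; ring.
rewrite (hpoly_split eQ).
rewrite mulr_suml; apply: eq_bigr => u _.
rewrite mulr_sumr; apply: eq_bigr => v _; rewrite -!exprD (wt_qvec _ eQ); congr ('X^_).
have hv := ltn_ord v.
rewrite (@divn_scale (1 + x2) _ ((1 + x3) * (1 + x1 * (1 + x2)))) //; last by ring.
rewrite (@divn_scale (1 + x1 * (1 + x2)) _ ((1 + x3) * (1 + x2))) //; last by ring.
rewrite (@divn_scale ((1 + x1 * (1 + x2)) * (1 + x2)) _ (1 + x3)) //.
rewrite !divnMA !divnMDl // (divn_small hv) addn0.
have := @twist_exp_le x1 (1 + x2) u isT; rewrite /=.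
move: (_ %/ _)%N (_ %/ _)%N => k l; nia.
Qed.

(** Here the leading digit s < 1 + x1 splits off: it contributes exactly s to the weight, and the
    remainder u contributes the exponent of [twist]. *)
Lemma hpoly_iv x1 x2 x3 :
  hpoly (qvec 1 ((1 + x1) * (1 + x3)) ((1 + x1) * (1 + x2 * (1 + x3))) x1 x2 x3)
  = twist x2 (1 + x3) * geom (1 + x1).
Proof.
have eQ : ((1 + x1) * ((1 + x2 * (1 + x3)) * (1 + x3)) =
  (sumn (qvec 1 ((1 + x1) * (1 + x3)) ((1 + x1) * (1 + x2 * (1 + x3))) x1 x2 x3)).+1)%N.
  by rewrite sumn_qvec; ring.
rewrite (hpoly_split eQ) mulrC.
rewrite mulr_suml; apply: eq_bigr => s _.
rewrite mulr_sumr; apply: eq_bigr => u _; rewrite -!exprD (wt_qvec _ eQ); congr ('X^_).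
have hs := ltn_ord s; have hu := ltn_ord u.
set b := (s * _ + u)%N.
rewrite mul1n divn_small; last by rewrite /b; nia.
rewrite (@divn_scale ((1 + x1) * (1 + x3)) _ (1 + x2 * (1 + x3))) //; last by ring.
rewrite (@divn_scale ((1 + x1) * (1 + x2 * (1 + x3))) _ (1 + x3)) //; last by ring.
have -> : (b %/ (1 + x2 * (1 + x3)) = s * (1 + x3) + u %/ (1 + x2 * (1 + x3)))%N.
  by rewrite -divnMDl //; congr (_ %/ _)%N; rewrite /b; ring.
have -> : (b %/ (1 + x3) = s * (1 + x2 * (1 + x3)) + u %/ (1 + x3))%N.
  by rewrite -divnMDl //; congr (_ %/ _)%N; rewrite /b; ring.
rewrite /b.
have := @twist_exp_le x2 (1 + x3) u isT; rewrite /=.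
move: (_ %/ _)%N (_ %/ _)%N => k l; nia.
Qed.

Theorem theorem4p6 (x1 x2 x3 : nat) :
  (0 < x1)%N -> (0 < x2)%N -> (0 < x3)%N ->
  forall r1 r2 r3 : nat,
    (* (i) *)
    [/\ r1 = 1%N, r2 = (1 + x1)%N & r3 = ((1 + x1) * (1 + x2))%N] \/
    (* (ii) *)
    [/\ r1 = (1 + x2)%N, r2 = (1 + x1 * (1 + x2))%N
      & r3 = ((1 + x1 * (1 + x2)) * (1 + x2))%N] \/
    (* (iv) *)
    [/\ r1 = 1%N, r2 = ((1 + x1) * (1 + x3))%N
      & r3 = ((1 + x1) * (1 + x2 * (1 + x3)))%N] ->
    unimodal (hstar_coef (simplex_verts (qvec r1 r2 r3 x1 x2 x3))).
Proof.
move=> x1_gt0 x2_gt0 x3_gt0 r1 r2 r3.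
case=> [|[]] [-> -> ->]; apply: symunimodal_unimodal (hstar_simplex _) _.
- rewrite hpoly_i; do 2![apply: symunimodalMgeom]; exact: symunimodal_geom.
- by rewrite hpoly_ii; apply: symunimodalMgeom; apply: symunimodal_twist.
- by rewrite hpoly_iv; apply: symunimodalMgeom; apply: symunimodal_twist.
Qed.
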